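(* Let $n\ge2$, let $\mathcal{X}=\{x_i\}_{i=1}^m$ be a frame for $\mathbb{R}^n$, and let $\tilde{\theta}_{\mathcal{X}}$ be the reduced diagram matrix of $\mathcal{X}$. Assume that $\tilde{\theta}_{\mathcal{X}}$ has rank $m-1$ and let $R_1,\dots,R_{m-1}\in\mathbb{R}^m$ be $m-1$ linearly independent rows of $\tilde{\theta}_{\mathcal{X}}$. Let $E=(\alpha_1,\dots,\alpha_m)$ be a vector of coefficients, and let $A$ be the $m\times m$ matrix whose rows are $E,R_1,\dots,R_{m-1}$ (in this order). Then $\mathcal{X}$ is scalable if and only if the cofactors of the $\alpha_j$'s in the expansion of $\det(A)$ are all non-negative or all non-positive.
   Context: A sequence $\{x_i\}_{i=1}^m\subset\mathbb{R}^n$ is a frame for $\mathbb{R}^n$ if there are $0<A_0\le B_0<\infty$ with $A_0\|x\|^2\le\sum_{i=1}^m|\langle x,x_i\rangle|^2\le B_0\|x\|^2$ for all $x\in\mathbb{R}^n$; it is tight if one can take $A_0=B_0$. A frame $\{x_i\}_{i=1}^m$ is scalable if there exist non-negative constants $a_1,\dots,a_m$ such that $\{a_ix_i\}_{i=1}^m$ is a tight frame. For $x=(x(1),\dots,x(n))\in\mathbb{R}^n$ with $n\ge2$, the reduced diagram vector $\tilde{x}\in\mathbb{R}^{(n-1)(n+2)/2}$ is $\frac{1}{\sqrt{n-1}}$ times the vector whose first $n-1$ entries are $x(1)^2-x(j)^2$, $j=2,\dots,n$, and whose remaining $n(n-1)/2$ entries are $\sqrt{2n}\,x(i)x(j)$,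 $1\le i<j\le n$. The reduced diagram matrix $\tilde{\theta}_{\mathcal{X}}$ is the $\frac{(n-1)(n+2)}{2}\times m$ matrix whose $i$-th column is $\tilde{x}_i$. The cofactor of the entry in position $(i,j)$ of a square matrix is $(-1)^{i+j}$ times the determinant of the submatrix obtained by deleting row $i$ and column $j$; in particular the cofactors of $\alpha_1,\dots,\alpha_m$ here do not depend on the values of the $\alpha_j$.
   Formalization: The frame vectors are additionally assumed to be all nonzero; with a zero vector and rank m−1 the cofactors always share a sign but the frame is never scalable, e.g. {(1,0),(1,1),(0,0)} in R^2. *)

(* Defs.v *)
From HB Require Import structures.
From mathcomp Require Import all_boot all_order all_algebra.
From mathcomp Require Import reals.

Set Implicit Arguments.
Unset Strict Implicit.
Unset Printing Implicit Defensive.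

Import Order.TTheory GRing.Theory Num.Theory.
Local Open Scope ring_scope.

Definition inner (R : realType) (n : nat) (x y : 'rV[R]_n) : R :=
  \sum_(k < n) x 0 k * y 0 k.

Definition enorm (R : realType) (n : nat) (x : 'rV[R]_n) : R :=
  Num.sqrt (inner x x).

Definition frame_bounds (R : realType) (n m : nat)
    (X : 'I_m -> 'rV[R]_n) (A B : R) : Prop :=
  [/\ 0 < A, A <= B
    & forall x : 'rV[R]_n,
        A * enorm x ^+ 2 <= \sum_(i < m) `|inner x (X i)| ^+ 2
                         <= B * enorm x ^+ 2].

Definition frame (R : realType) (n m : nat) (X : 'I_m -> 'rV[R]_n) : Prop :=
  exists A B : R, frame_bounds X A B.

Definition tight_frame (R : realType) (n m : nat)
    (X : 'I_m -> 'rV[R]_n) : Prop :=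
  exists A : R, frame_bounds X A A.

Definition scalable_frame (R : realType) (n m : nat)
    (X : 'I_m -> 'rV[R]_n) : Prop :=
  exists a : 'I_m -> R,
    (forall i, 0 <= a i) /\ tight_frame (fun i => a i *: X i).

Definition lt_pairs (n : nat) : {set 'I_n * 'I_n} :=
  [set p : 'I_n * 'I_n | (p.1 < p.2)%N].

Lemma card_lt_pairs (n : nat) : #|lt_pairs n| = 'C(n, 2).
Proof.
rewrite -sum1dep_card.
rewrite (eq_bigr (fun p => (fun _ _ : 'I_n => 1%N) p.1 p.2)) //.
rewrite -(pair_big_dep xpredT (fun i j : 'I_n => i < j)%N (fun _ _ => 1%N)) /=.
rewrite (exchange_big_dep xpredT) //= -bin2_sum big_mkord.
apply: eq_bigr => j _; rewrite sum1_card.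
rewrite -[RHS](size_iota 0) cardE -(size_map val) /=.
apply/perm_size/uniq_perm.
- by rewrite map_inj_uniq ?enum_uniq //; apply: val_inj.
- exact: iota_uniq.
move=> k; rewrite mem_iota add0n /=; apply/mapP/idP => [[i]|k_lt].
  by rewrite mem_enum => hi ->.
by exists (Ordinal (ltn_trans k_lt (ltn_ord j))); rewrite ?mem_enum.
Qed.

Lemma reduced_diagram_dim (n : nat) :
  (n + #|lt_pairs n.+1| = (n * (n.+1 + 2))./2)%N.
Proof.
rewrite card_lt_pairs bin2 /=.
have -> : (n * (n.+1 + 2) = n.*2 + n.+1 * n)%N.
  by rewrite -muln2 [(n.+1 * n)%N]mulnC -mulnDr addnC.
by rewrite halfD odd_double doubleK.
Qed.

(* The ambient dimension is n.+1, so the scalars 1/sqrt(dim - 1) and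
   sqrt(2 dim) read as below.  Coordinates are numbered from 0: the first block
   lists x(0)^2 - x(j)^2 for j = 1, ..., n, the second one the products
   x(i) x(j) for i < j, in the order of [enum (lt_pairs n.+1)]. *)
Definition reduced_diagram (R : realType) (n : nat) (x : 'rV[R]_n.+1) :
    'cV[R]_(n + #|lt_pairs n.+1|) :=
  (Num.sqrt n%:R)^-1 *:
    col_mx (\col_(j < n) (x 0 ord0 ^+ 2 - x 0 (lift ord0 j) ^+ 2))
           (\col_(k < #|lt_pairs n.+1|)
              (Num.sqrt (2 * n.+1)%:R *
                 x 0 (enum_val k).1 * x 0 (enum_val k).2)).

Definition reduced_diagram_mx (R : realType) (n m : nat)
    (X : 'I_m -> 'rV[R]_n.+1) : 'M[R]_(n + #|lt_pairs n.+1|, m) :=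
  \matrix_(i, j) reduced_diagram (X j) i 0.

(* Main.v *)
(* The kernel of the reduced diagram matrix consists of the weights b for which
   the matrix with entries sum_i b_i x_i(k) x_i(l) is scalar, so X is scalable
   iff this kernel contains a nonzero non-negative vector.  Deleting the row E,
   the cofactors along it form a nonzero vector orthogonal to all the remaining
   rows; as the rank is one less than the number of columns, that vector spans
   the kernel. *)
Require Import Defs.
From HB Require Import structures.
From mathcomp Require Import all_boot all_order all_algebra.
From mathcomp Require Import reals.
From mathcomp Require Import ring lra.

Set Implicit Arguments.
Unset Strict Implicit.
Unset Printing Implicit Defensive.

Import Order.TTheory GRing.Theory Num.Theory.
Local Open Scope ring_scope.

(** * Cofactors along the first row and the kernel of the remaining rows *)

Section CofactorVector.
Variables (F : fieldType) (m : nat).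
Implicit Types (E : 'rV[F]_m.+1) (M : 'M[F]_(m, m.+1)).

Definition cofactor_col (A : 'M[F]_m.+1) : 'cV[F]_m.+1 :=
  \col_j cofactor A ord0 j.

Lemma col_mx_lift0 E M i j : (col_mx E M : 'M_m.+1) (lift ord0 i) j = M i j.
Proof.
have -> : lift ord0 i = rshift 1 i :> 'I_(1 + m) by apply: val_inj.
exact: col_mxEd.
Qed.

(** Minors along the first row omit that row, so [E] may be traded for whichever row is
    convenient. *)
Lemma cofactor_col_row0 E E' M :
  cofactor_col (col_mx E M) = cofactor_col (col_mx E' M).
Proof.
apply/colP=> j; rewrite !mxE /cofactor; congr (_ * \det _).
by apply/matrixP=> i k; rewrite 2![LHS]mxE 2![RHS]mxE !col_mx_lift0.
Qed.

(** Expansion along alien cofactors: these are off-diagonal entries of [A *m \adj A], which is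
    [\det A] times the identity. *)
Lemma mul_cofactor_col E M : M *m cofactor_col (col_mx E M) = 0.
Proof.
apply/colP=> k; rewrite [RHS]mxE.
set A : 'M_m.+1 := col_mx E M.
have := mul_mx_adj A => /matrixP /(_ (lift ord0 k) ord0).
rewrite [in RHS]mxE /= mulr0n => <-.
rewrite [LHS]mxE [RHS]mxE; apply: eq_bigr => j _.
by rewrite [X in _ * X = _]mxE [X in _ = _ * X]mxE col_mx_lift0.
Qed.

(** The [m] rows of [M] cannot span the whole space, so some unit vector lies outside their span.
    Put in the first row, it gives an invertible matrix, whose determinant would vanish if all the
    cofactors did. *)
Lemma cofactor_col_neq0 E M : row_free M -> cofactor_col (col_mx E M) != 0.
Proof.
move=> freeM; apply/eqP=> c0.
have [j dj] : exists j, ~~ ((delta_mx 0 j : 'rV[F]_m.+1) <= M)%MS.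
  apply/existsP; rewrite -negb_forall; apply/negP => /forallP sub1M.
  have /mxrankS : ((1%:M : 'M[F]_m.+1) <= M)%MS.
    by apply/row_subP => i; rewrite row1.
  by rewrite mxrank1 (eqP freeM) ltnn.
pose e : 'rV[F]_m.+1 := delta_mx 0 j.
pose A : 'M_m.+1 := col_mx e M.
have /negP[] : A \notin unitmx.
  rewrite unitmxE unitfE negbK (expand_det_row _ ord0) big1 // => i _.
  have /colP/(_ i) := c0.
  by rewrite (cofactor_col_row0 E e) !mxE => ->; rewrite mulr0.
rewrite -row_free_unit /row_free -(addsmxE e M) eqn_leq rank_leq_col /=.
rewrite -{1}(eqP freeM) rank_ltmx // ltmxE addsmxSr /=.
by apply: contra dj; apply: submx_trans; apply: addsmxSl.
Qed.

(** By rank-nullity the kernel is a line, and the cofactor vector is a nonzero element of it.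
    Transposes appear because [kermx] is a left kernel. *)
Lemma row_free_ker_cofactor_col E M (v : 'cV[F]_m.+1) :
  row_free M -> M *m v = 0 -> exists t, v = t *: cofactor_col (col_mx E M).
Proof.
move=> freeM Mv0; set c := cofactor_col _.
have tr_ker (u : 'cV_m.+1) : M *m u = 0 -> (u^T <= kermx M^T)%MS.
  by move=> Mu0; apply/sub_kermxP; rewrite -trmx_mul Mu0 trmx0.
have rk1 : \rank (kermx M^T) = 1%N.
  by rewrite mxrank_ker mxrank_tr (eqP freeM) subSnn.
have rkc : \rank c^T = 1%N.
  by rewrite mxrank_tr; apply/eqP; rewrite -mxrank_tr rank_rV trmx_eq0
             cofactor_col_neq0.
have kerc : (kermx M^T <= c^T)%MS.
  rewrite -(mxrank_leqif_sup (tr_ker _ (mul_cofactor_col E M))).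
  by rewrite rk1 rkc.
have /sub_rVP[t vE] := submx_trans (tr_ker _ Mv0) kerc.
by exists t; rewrite -[v]trmxK vE linearZ /= trmxK.
Qed.

(** Independent rows, as many as the rank, span the row space, so [T] factors through them. *)
Lemma rank_rowsub_ker p (T : 'M[F]_(p, m.+1)) (f : 'I_m -> 'I_p)
    (v : 'cV[F]_m.+1) :
  \rank T = m -> row_free (rowsub f T) -> (T *m v = 0 <-> rowsub f T *m v = 0).
Proof.
move=> rkT freeM; split=> [Tv0|Mv0].
  by rewrite mul_rowsub_mx Tv0; apply/matrixP=> i j; rewrite !mxE.
have /submxP[D ->] : (T <= rowsub f T)%MS.
  by rewrite -(mxrank_leqif_sup (rowsub_sub f T)) (eqP freeM) rkT.
by rewrite -mulmxA Mv0 mulmx0.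
Qed.

End CofactorVector.

(** * Weighted Gram matrices, tight frames and scalability *)

Section Frames.
Variables (R : realType) (n m : nat) (X : 'I_m -> 'rV[R]_n.+1).

(** For [b i 0 = a i ^+ 2] this is the matrix of the frame operator of the vectors [a i *: X i]. *)
Definition weighted_gram (b : 'cV[R]_m) (k l : 'I_n.+1) : R :=
  \sum_i b i 0 * X i 0 k * X i 0 l.

Lemma weighted_gramC b k l : weighted_gram b k l = weighted_gram b l k.
Proof. by apply: eq_bigr => i _; rewrite mulrAC. Qed.

(** Up to nonzero factors, the first block of rows compares the diagonal Gram entries with the first
    one, and the second block reads off the entries above the diagonal. *)
Lemma reduced_diagram_mx_ker (b : 'cV[R]_m) : (0 < n)%N ->
  reduced_diagram_mx X *m b = 0 <->
  (forall k l, weighted_gram b k l = weighted_gram b ord0 ord0 *+ (k == l)).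
Proof.
move=> n_gt0.
have sn0 : (Num.sqrt n%:R)^-1 != 0 :> R.
  by rewrite invr_eq0 gt_eqF // sqrtr_gt0 ltr0n.
have s2n0 : Num.sqrt (2 * n.+1)%:R != 0 :> R by rewrite gt_eqF // sqrtr_gt0 ltr0n.
have Eu j : (reduced_diagram_mx X *m b) (lshift _ j) 0 =
   (Num.sqrt n%:R)^-1 *
   (weighted_gram b ord0 ord0 - weighted_gram b (lift ord0 j) (lift ord0 j)).
  rewrite -sumrB mulr_sumr mxE; apply: eq_bigr => i _.
  rewrite 2![X in X * _ = _]mxE col_mxEu mxE !expr2 -!mulrA; congr (_ * _).
  by rewrite -mulrBr mulrC.
have Ed k : (reduced_diagram_mx X *m b) (rshift _ k) 0 =
   (Num.sqrt n%:R)^-1 * (Num.sqrt (2 * n.+1)%:R *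
      weighted_gram b (enum_val k).1 (enum_val k).2).
  rewrite !mulr_sumr mxE; apply: eq_bigr => i _.
  rewrite 2![X in X * _ = _]mxE col_mxEd mxE -!mulrA; congr (_ * (_ * _)).
  by rewrite mulrC -mulrA mulrCA mulrA mulrC mulrCA.
split=> [T0 k l|G].
  have off (i j : 'I_n.+1) : (i < j)%N -> weighted_gram b i j = 0.
    move=> ltij; have ijP : (i, j) \in lt_pairs n.+1 by rewrite inE.
    have := Ed (enum_rank_in ijP (i, j)).
    rewrite enum_rankK_in // T0 mxE /= => /esym/eqP.
    by rewrite !mulf_eq0 (negPf sn0) (negPf s2n0) => /eqP.
  have [<-|] := eqVneq k l.
    case: (unliftP ord0 k) => [j|] -> //; rewrite mulr1n; apply/esym/eqP.
    have /esym/eqP := Eu j.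
    by rewrite T0 mxE mulf_eq0 (negPf sn0) subr_eq0.
  rewrite -val_eqE neq_ltn mulr0n => /orP[/off //|/off].
  by rewrite weighted_gramC.
apply/colP=> i; rewrite [RHS]mxE; case: (split_ordP i) => j ->.
  by rewrite Eu [weighted_gram _ (lift _ _) _]G eqxx subrr mulr0.
rewrite Ed G; have := enum_valP j; rewrite inE => /ltn_eqF.
by rewrite val_eqE => ->; rewrite mulr0n !mulr0.
Qed.

Lemma enorm_sqr (x : 'rV[R]_n.+1) : enorm x ^+ 2 = \sum_k x 0 k ^+ 2.
Proof.
rewrite /enorm sqr_sqrtr; first by apply: eq_bigr => k _; rewrite expr2.
by apply: sumr_ge0 => k _; rewrite -expr2 sqr_ge0.
Qed.

Lemma frame_operator_quadratic (a : 'I_m -> R) (x : 'rV[R]_n.+1) :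
  \sum_i `|inner x (a i *: X i)| ^+ 2 =
  \sum_k \sum_l x 0 k * x 0 l * weighted_gram (\col_i (a i ^+ 2)) k l.
Proof.
under [RHS]eq_bigr => k _ do
  (under eq_bigr => l _ do rewrite mulr_sumr; rewrite exchange_big).
rewrite exchange_big /=; apply: eq_bigr => i _.
rewrite real_normK ?num_real // expr2 /inner mulr_suml.
apply: eq_bigr => k _; rewrite mulr_sumr; apply: eq_bigr => l _.
by rewrite !mxE; ring.
Qed.

(** A symmetric matrix is determined by its quadratic form, and tightness says that this form is [A]
    times the squared norm. *)
Lemma tight_frame_gram (a : 'I_m -> R) (A : R) :
  frame_bounds (fun i => a i *: X i) A A <->
  0 < A /\ forall k l, weighted_gram (\col_i (a i ^+ 2)) k l = A *+ (k == l).
Proof.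
set G := weighted_gram _.
split=> [[A0 _ hA]|[A0 hG]]; last first.
  split=> // x; apply/andP; rewrite frame_operator_quadratic -/G enorm_sqr.
  suff -> : \sum_k \sum_l x 0 k * x 0 l * G k l = A * \sum_k x 0 k ^+ 2 by [].
  rewrite mulr_sumr; apply: eq_bigr => k _.
  rewrite (bigD1 k) //= hG eqxx mulr1n big1 ?addr0 => [|l]; first by rewrite mulrC.
  by rewrite eq_sym hG => /negPf ->; rewrite mulr0.
(* Equal frame bounds squeeze the two inequalities into an equality. *)
have {}hA (x : 'rV[R]_n.+1) : \sum_k \sum_l x 0 k * x 0 l * G k l = A * \sum_k x 0 k ^+ 2.
  by rewrite -(frame_operator_quadratic a) -enorm_sqr; apply/esym/le_anti/hA.
split=> //.
pose e (k : 'I_n.+1) : 'rV[R]_n.+1 := delta_mx 0 k.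
have sume (k : 'I_n.+1) (h : 'I_n.+1 -> R) : \sum_l e k 0 l * h l = h k.
  rewrite (bigD1 k) //= big1 ?addr0 ?mxE ?eqxx ?mul1r // => l /negPf lk.
  by rewrite mxE lk mul0r.
have sum2e k l : \sum_i \sum_j e k 0 i * e l 0 j * G i j = G k l.
  under eq_bigr => i _ do
    (under eq_bigr => j _ do rewrite -mulrA; rewrite -mulr_sumr).
  by rewrite sume sume.
have sqe k l : \sum_i e k 0 i * e l 0 i = (k == l)%:R.
  by rewrite sume mxE.
have diag k : G k k = A.
  rewrite -sum2e hA; under eq_bigr do rewrite expr2.
  by rewrite sqe eqxx mulr1.
move=> k l; have [<-|kl] := eqVneq k l; first by rewrite diag.
(* Polarization at e_k + e_l. *)
have := hA (e k + e l).
have -> : \sum_i (e k + e l) 0 i ^+ 2 = 2.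
  under eq_bigr do rewrite mxE expr2 mulrDl !mulrDr.
  by rewrite !big_split /= !sqe !eqxx [l == k]eq_sym (negPf kl) addr0 add0r.
have -> : \sum_i \sum_j (e k + e l) 0 i * (e k + e l) 0 j * G i j =
    G k k + G k l + (G l k + G l l).
  rewrite -!sum2e -!big_split; apply: eq_bigr => i _; rewrite -!big_split.
  apply: eq_bigr => j _ /=; rewrite !mxE.
  by rewrite mulrDl !mulrDr !mulrDl.
rewrite [G l k]weighted_gramC -/(G k l) !diag mulr0n; lra.
Qed.

(** The correspondence between scalings and kernel vectors is [b i 0 = a i ^+ 2]. *)
Lemma scalable_frame_ker : (0 < n)%N -> (forall i, X i != 0) ->
  scalable_frame X <->
  exists b : 'cV[R]_m,
    [/\ b != 0, forall i, 0 <= b i 0 & reduced_diagram_mx X *m b = 0].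
Proof.
move=> n_gt0 X0; split=> [[a [_ [A /tight_frame_gram[A0 hG]]]]|[b [bn0 b0 Tb0]]].
  exists (\col_i (a i ^+ 2)); split=> [|i|].
  - apply/eqP=> b0; have := hG ord0 ord0; rewrite b0 /weighted_gram.
    by rewrite big1 => [A00|i _]; [rewrite A00 eqxx ltxx in A0|rewrite mxE !mul0r].
  - by rewrite mxE sqr_ge0.
  by apply/reduced_diagram_mx_ker => // k l; rewrite !hG eqxx.
have {Tb0} := (reduced_diagram_mx_ker b n_gt0).1 Tb0.
set A := weighted_gram b ord0 ord0 => hG.
exists (fun i => Num.sqrt (b i 0)); split=> [i|]; first exact: sqrtr_ge0.
exists A; apply/tight_frame_gram.
have -> : \col_i (Num.sqrt (b i 0) ^+ 2) = b.
  by apply/colP=> i; rewrite mxE sqr_sqrtr.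
split=> //.
(* Positivity of [A]: as a diagonal entry at [k], it is a sum of non-negative terms, and the term of
   index [i] is nonzero. *)
have /cV0Pn[i bi] := bn0; have /rV0Pn[k xk] := X0 i.
have <- : weighted_gram b k k = A by rewrite hG eqxx.
have term_ge0 j : 0 <= b j 0 * X j 0 k * X j 0 k.
  by rewrite -mulrA -expr2 mulr_ge0 ?sqr_ge0.
rewrite /weighted_gram (bigD1 i) //= ltr_pwDl ?sumr_ge0 //.
by rewrite lt_neqAle term_ge0 eq_sym !mulf_neq0.
Qed.

End Frames.

(* The space is R^(n.+1) and the frame has m.+1 vectors.  The frame vectors are
   assumed non-zero: if one of them is zero and the rank is m, the cofactors all
   have the same sign while X is not scalable. *)
Theorem theorem3p11 (R : realType) (n m : nat)
    (hn : (2 <= n.+1)%N)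
    (X : 'I_m.+1 -> 'rV[R]_n.+1)
    (hX : frame X)
    (hX0 : forall i : 'I_m.+1, X i != 0)
    (hrank : \rank (reduced_diagram_mx X) = m)
    (f : 'I_m -> 'I_(n + #|lt_pairs n.+1|))
    (hf : row_free (rowsub f (reduced_diagram_mx X)))
    (E : 'rV[R]_m.+1)
    (A : 'M[R]_m.+1)
    (hA : A = col_mx E (rowsub f (reduced_diagram_mx X))) :
  scalable_frame X <->
    ((forall j : 'I_m.+1, 0 <= cofactor A ord0 j) \/
     (forall j : 'I_m.+1, cofactor A ord0 j <= 0)).
Proof.
rewrite (scalable_frame_ker hn hX0).
set M := rowsub f _ in hf hA; set c := cofactor_col (col_mx E M).
have cE j : cofactor A ord0 j = c j 0 by rewrite hA mxE.
have Tc0 : reduced_diagram_mx X *m c = 0.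
  by apply/(rank_rowsub_ker c hrank hf)/mul_cofactor_col.
have cn0 : c != 0 by apply: cofactor_col_neq0.
split=> [[b [bn0 b0 /(rank_rowsub_ker b hrank hf) Mb0]]|].
  have [t bE] := row_free_ker_cofactor_col E hf Mb0.
  rewrite -/c in bE.
  have tc j : 0 <= t * c j 0 by have := b0 j; rewrite bE mxE.
  (* The sign of [t] decides the common sign of the cofactors; [t = 0] would force [b = 0]. *)
  have [t0|t0|t0] := ltrgt0P t; [left=> j|right=> j|].
  - by rewrite cE -(pmulr_rge0 _ t0).
  - by rewrite cE -(nmulr_rge0 _ t0).
  by rewrite bE t0 scale0r eqxx in bn0.
case=> hc; [exists c|exists (- c)]; split=> [|i|] //.
- by rewrite -cE.
- by rewrite oppr_eq0.
- by rewrite mxE oppr_ge0 -cE.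
by rewrite mulmxN Tc0 oppr0.
Qed.
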